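(* For all natural numbers $n$ and $k$, the number of orbits of size $k$ of the topdrop map in $S_n$ equals $$\sum_{\{\mathcal{N}\in A_n\,:\,|\mathcal{N}|=k\}}\frac{\bigl(n-d(\mathcal{N})\bigr)!}{P(\mathcal{N})},$$ where $d(\mathcal{N})$ is the number of distinct values appearing in $\mathcal{N}$ and $|\mathcal{N}|$ is the size of $\mathcal{N}$.
   Context: Permutations are in one-line notation $\pi=\pi_1\cdots\pi_n$. The topdrop map $T:S_n\to S_n$ is $T(\pi_1\cdots\pi_n)=\pi_{\pi_1+1}\cdots\pi_n\,\pi_{\pi_1}\pi_{\pi_1-1}\cdots\pi_1$ (first $\pi_1$ entries removed, reversed, appended at the end); it is a bijection. The orbit of $\pi$ is $(\pi,T(\pi),\dots,T^{s-1}(\pi))$ with $s\ge1$ minimal such that $T^s(\pi)=\pi$; $s$ is its size. The topdrop-necklace of $\pi$ is the cyclic sequence $[\pi_1,T(\pi)_1,\dots,T^{s-1}(\pi)_1]$ up to cyclic rotation; its size is $s$. $A_n$ is the set of topdrop-valid necklaces in $S_n$, i.e. those arising as the topdrop-necklace of some $\pi\in S_n$. For a necklace $\mathcal{N}=[x_1,\dots,x_s]$, let $t$ be the least $t\ge1$ with $x_{i+t}=x_i$ for all $i$ (indices mod $s$); the fundamental period is $P(\mathcal{N})=s/t$. *)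

(* Defs.v *)
From mathcomp Require Import all_boot perm all_algebra.
From mathcomp Require Import zify.

Set Implicit Arguments.
Unset Strict Implicit.
Unset Printing Implicit Defensive.

Import GRing.Theory.

(* Positions are the ordinals 0, ..., n-1; the values are shifted by one so
   that they are 1, ..., n. *)
Definition oneline n (s : 'S_n) : seq nat := [seq (s i).+1 | i <- enum 'I_n].

(* The empty word (n = 0) has no first entry: there [top_entry] is 0 by
   convention, and [topdrop] below is the identity of 'S_0. *)
Definition top_entry n (s : 'S_n) : nat := head 0 (oneline s).

(* For m = s_1, entry i of T(s) is entry i + m of s as long as i + m < n, and
   entry n - 1 - i of s after that, which is the reversed prefix; the lemma
   [oneline_topdrop] below restates this on words. *)
Definition topdrop_pos n (m : nat) (i : 'I_n) : 'I_n :=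
  insubd (rev_ord i) (i + m).

Lemma val_topdrop_pos n m (i : 'I_n) :
  topdrop_pos m i = (if i + m < n then i + m else n - i.+1) :> nat.
Proof. by rewrite /topdrop_pos val_insubd; case: ifP. Qed.

Lemma topdrop_pos_inj n m : injective (@topdrop_pos n m).
Proof.
move=> i j /(congr1 val) /=; rewrite !val_topdrop_pos => e.
have := ltn_ord i; have := ltn_ord j => ltj lti.
by apply: ord_inj; move: e; case: (ltnP (i + m)); case: (ltnP (j + m)); lia.
Qed.

Definition topdrop n (s : 'S_n) : 'S_n :=
  perm (inj_comp (@perm_inj _ s) (@topdrop_pos_inj n (top_entry s))).

Lemma topdropE n (s : 'S_n) i : topdrop s i = s (topdrop_pos (top_entry s) i).
Proof. by rewrite permE. Qed.

Lemma size_oneline n (s : 'S_n) : size (oneline s) = n.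
Proof. by rewrite size_map size_enum_ord. Qed.

Lemma nth_oneline n (s : 'S_n) (i : 'I_n) : nth 0 (oneline s) i = (s i).+1.
Proof. by rewrite (nth_map i) ?size_enum_ord // nth_ord_enum. Qed.

Lemma top_entryS n (s : 'S_n.+1) : top_entry s = (s ord0).+1.
Proof. by rewrite -nth_oneline nth0. Qed.

Lemma top_entry_le n (s : 'S_n) : top_entry s <= n.
Proof.
case: n s => [|n] s; last by rewrite top_entryS ltn_ord.
by rewrite /top_entry; have := size_oneline s; case: (oneline s).
Qed.

Lemma oneline_topdrop n (s : 'S_n) :
  let m := top_entry s in
  oneline (topdrop s) = drop m (oneline s) ++ rev (take m (oneline s)).
Proof.
move=> m; have le_mn : m <= n := top_entry_le s.
have sz_t : size (take m (oneline s)) = m.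
  by rewrite size_takel // size_oneline.
have sz : size (drop m (oneline s) ++ rev (take m (oneline s))) = n.
  by rewrite size_cat size_rev sz_t size_drop size_oneline subnK.
apply: (@eq_from_nth _ 0); first by rewrite sz size_oneline.
move=> i0; rewrite size_oneline => lt_i; pose i := Ordinal lt_i.
rewrite -[i0]/(nat_of_ord i) nth_oneline topdropE -nth_oneline val_topdrop_pos.
rewrite -/m nth_cat size_drop size_oneline /=; case: ltnP => h.
  by rewrite ifT ?nth_drop 1?addnC //; lia.
rewrite ifF; last by apply/negbTE; rewrite -leqNgt; lia.
rewrite nth_rev ?sz_t; last by lia.
rewrite nth_take; last by lia.
by congr nth; lia.
Qed.

Lemma topdrop_inj n : injective (@topdrop n).
Proof.
case: n => [|n] s u e; first by apply/permP => - [].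
have top_max (v : 'S_n.+1) : (topdrop v ord_max).+1 = top_entry v.
  rewrite topdropE top_entryS; congr (nat_of_ord (v _)).+1.
  by apply: ord_inj; rewrite val_topdrop_pos /= ifF ?subnn //; lia.
have eq_top : top_entry s = top_entry u by rewrite -!top_max e.
apply/permP => i.
have [g _ gK] := injF_bij (@topdrop_pos_inj n.+1 (top_entry s)).
by rewrite -(gK i) -topdropE e topdropE -eq_top.
Qed.

(* [order] is the least positive period, as for any injective map. *)
Lemma topdrop_orderP n (s : 'S_n) :
  [/\ 0 < order (@topdrop n) s,
      iter (order (@topdrop n) s) (@topdrop n) s = s &
      forall k, 0 < k -> iter k (@topdrop n) s = s ->
        order (@topdrop n) s <= k].
Proof.
split; first by rewrite -orderSpred.
  exact: iter_order (@topdrop_inj n) s.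
move=> k k_gt0 e; rewrite leqNgt; apply/negP => lt_k.
have := findex_iter lt_k; rewrite e findex0 => k0.
by rewrite -k0 in k_gt0.
Qed.

(* An orbit has pairwise distinct terms and T sends each term to the
   (cyclically) next one, so up to its starting point it is determined by its
   set of terms, and its size is the cardinality of that set. *)
Definition topdrop_orbits n : {set {set 'S_n}} :=
  [set [set u in orbit (@topdrop n) s] | s : 'S_n].

Definition rot_equiv (u v : seq nat) : bool :=
  [exists i : 'I_(size u).+1, v == rot i u].

Lemma rot_equivP u v : reflect (exists i, v = rot i u) (rot_equiv u v).
Proof.
apply: (iffP existsP) => [[i /eqP ->]|[i ->]]; first by exists i.
have le : minn i (size u) < (size u).+1 by rewrite ltnS geq_minr.
by exists (Ordinal le); rewrite /= -rot_minn.
Qed.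

Lemma rot_equiv_refl : reflexive rot_equiv.
Proof. by move=> u; apply/rot_equivP; exists 0; rewrite rot0. Qed.

Lemma rot_equiv_sym : symmetric rot_equiv.
Proof.
suff h u v : rot_equiv u v -> rot_equiv v u by move=> u v; apply/idP/idP => /h.
case/rot_equivP=> i ->; apply/rot_equivP.
by exists (size (rot i u) - i); rewrite -[LHS](rotK i).
Qed.

Lemma rot_equiv_trans : transitive rot_equiv.
Proof.
move=> v u w /rot_equivP[i ->] /rot_equivP[j ->]; apply/rot_equivP.
rewrite (rot_minn i) (rot_minn j) rot_add_mod ?size_rot ?geq_minr //.
by eexists; reflexivity.
Qed.

Definition rot_equivalence : equiv_rel (seq nat) :=
  EquivRel rot_equiv rot_equiv_refl rot_equiv_sym rot_equiv_trans.

Definition necklace := {eq_quot rot_equivalence}%qT.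

Definition to_necklace (w : seq nat) : necklace := (\pi_necklace w)%qT.

Lemma to_necklaceP u v :
  reflect (exists i, v = rot i u) (to_necklace u == to_necklace v).
Proof.
apply: (iffP idP) => [/eqP/eqmodP/rot_equivP //|h].
by apply/eqP/eqmodP/rot_equivP.
Qed.

Lemma repr_to_necklace w : exists i, repr (to_necklace w) = rot i w.
Proof. by apply/to_necklaceP; rewrite /to_necklace reprK. Qed.

Definition is_period (w : seq nat) (t : nat) : bool :=
  (0 < t) && [forall i : 'I_(size w), nth 0 w ((i + t) %% size w) == nth 0 w i].

Lemma exists_period w : exists t, is_period w t.
Proof.
exists (size w).-1.+1; apply/andP; split=> //; apply/forallP => i.
by rewrite prednK ?modnDr ?modn_small //; case: (size w) i => // - [].
Qed.

Definition least_period (w : seq nat) : nat := ex_minn (exists_period w).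

Definition num_values (w : seq nat) : nat := size (undup w).

Definition necklace_size (N : necklace) : nat := size (repr N).

Definition necklace_num_values (N : necklace) : nat := num_values (repr N).

Definition fundamental_period (N : necklace) : rat :=
  ((size (repr N))%:R / (least_period (repr N))%:R)%R.

(* The three quantities above do not depend on the representative. *)
Lemma necklace_sizeE w : necklace_size (to_necklace w) = size w.
Proof.
by rewrite /necklace_size; have [i ->] := repr_to_necklace w; rewrite size_rot.
Qed.

Lemma necklace_num_valuesE w :
  necklace_num_values (to_necklace w) = num_values w.
Proof.
rewrite /necklace_num_values; have [i ->] := repr_to_necklace w.
by apply/perm_size/perm_undup => x; rewrite mem_rot.
Qed.

Lemma nth_rot i w j : i <= size w -> j < size w ->
  nth 0 (rot i w) j = nth 0 w ((i + j) %% size w).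
Proof.
move=> le_i lt_j; rewrite nth_cat size_drop nth_drop; case: ltnP => h.
  by rewrite modn_small //; lia.
rewrite nth_take; last by lia.
have -> : i + j = j - (size w - i) + size w by lia.
by rewrite modnDr modn_small //; lia.
Qed.

Lemma least_period_rot i w : least_period (rot i w) = least_period w.
Proof.
suff per_rot v k t : is_period v t -> is_period (rot k v) t.
  have eq_per t : is_period (rot i w) t = is_period w t.
    apply/idP/idP => [|/per_rot //].
    by move/(@per_rot _ (size (rot i w) - i)); rewrite -/(rotr i _) rotK.
  rewrite /least_period; case: ex_minnP => a pa mina.
  case: ex_minnP => b pb minb; apply/eqP; rewrite eqn_leq.
  by rewrite mina ?eq_per // minb // -eq_per.
case/andP=> t_gt0 /forallP per; rewrite /is_period t_gt0.
rewrite rot_minn; set c := minn k _; have le_c : c <= size v := geq_minr _ _.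
apply/forallP => - [j /=]; rewrite size_rot => lt_j.
have v_gt0 : 0 < size v by lia.
rewrite !nth_rot ?ltn_pmod //.
have /eqP <- := per (Ordinal (ltn_pmod (c + j) v_gt0)).
by rewrite /= modnDmr modnDml addnA.
Qed.

Lemma fundamental_periodE w :
  fundamental_period (to_necklace w) =
  ((size w)%:R / (least_period w)%:R)%R.
Proof.
rewrite /fundamental_period; have [i ->] := repr_to_necklace w.
by rewrite size_rot least_period_rot.
Qed.

Definition topdrop_necklace n (s : 'S_n) : necklace :=
  to_necklace [seq top_entry u | u <- orbit (@topdrop n) s].

(* The set A_n, listed without repetition. *)
Definition valid_necklaces n : seq necklace :=
  undup [seq topdrop_necklace s | s : 'S_n].

Lemma valid_necklacesP n N :
  reflect (exists s : 'S_n, N = topdrop_necklace s) (N \in valid_necklaces n).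
Proof.
by rewrite mem_undup; apply: (iffP imageP) => [[s _ ->]|[s ->]]; exists s.
Qed.

(* Main.v *)
(* Multiplying values by a permutation [g] that fixes every first entry occurring
   along the orbit of [s] commutes with the whole trajectory, and conversely two
   permutations with the same word of first entries differ by such a [g].  So a
   word with [d] distinct values is read off exactly [(n - d)!] permutations.  A
   necklace of size [k] and least period [t] consists of [t] distinct words, all
   of them read along the same orbits, and so accounts for [t * (n - d)!]
   permutations, hence for [t * (n - d)! / k] orbits of size [k]. *)
Require Import Defs.
From mathcomp Require Import all_boot perm all_algebra.
From mathcomp Require Import zify.

Set Implicit Arguments.
Unset Strict Implicit.
Unset Printing Implicit Defensive.

Import GRing.Theory.

(** * Orbits of a given size *)

Lemma card_order_orbits (T : finType) (f : T -> T) k : injective f ->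
  #|[set x | order f x == k]| =
  #|[set O in [set [set u in orbit f s] | s : T] | #|O| == k]| * k.
Proof.
move=> f_inj; have card_orb s : #|[set u in orbit f s]| = order f s.
  by rewrite cardsE (card_uniqP (orbit_uniq f s)) size_orbit.
set D := [set x | _]; set P := [set O in _ | _].
apply: card_uniform_partition => [O|]; first by rewrite inE => /andP[_ /eqP].
have connP : {in D & &, equivalence_rel (fconnect f)}.
  move=> x y z _ _ _; split=> [|xy]; first exact: connect0.
  exact: (same_connect (fconnect_sym f_inj) xy).
(* Injectivity of [f] makes [fconnect f] an equivalence. Connected points have the same order, so an
   orbit meeting [D] stays in [D], and the orbits of size [k] are exactly the classes of [D]. *)
suff -> : P = equivalence_partition (fconnect f) D.
  exact: equivalence_partitionP connP.
have eqO s : s \in D -> [set u in orbit f s] = [set u in D | fconnect f s u].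
  rewrite inE => /eqP Ds; apply/setP => u; rewrite !inE -fconnect_orbit.
  case c: (fconnect f s u); rewrite ?andbF // andbT.
  rewrite -Ds; apply/esym/eqP/esym/eq_card => z.
  exact: (same_connect (fconnect_sym f_inj) c).
apply/setP => O; rewrite inE; apply/andP/imsetP.
  case=> /imsetP[s _ ->]; rewrite card_orb => Ds.
  by have sD : s \in D by [rewrite inE]; exists s => //; apply: eqO.
case=> s sD ->; rewrite -eqO // card_orb; split; first exact: imset_f.
by move: sD; rewrite inE.
Qed.

(** * Periods and rotations of words *)

Lemma least_periodP (w : seq nat) : is_period w (least_period w).
Proof. by rewrite /least_period; case: ex_minnP. Qed.

Lemma least_period_min w t : is_period w t -> least_period w <= t.
Proof. by rewrite /least_period; case: ex_minnP => m _; apply. Qed.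

Lemma least_period_gt0 w : 0 < least_period w.
Proof. by case/andP: (least_periodP w). Qed.

Lemma is_periodP w t : 0 < size w -> 0 < t ->
  reflect (forall i, nth 0 w ((i + t) %% size w) = nth 0 w (i %% size w))
          (is_period w t).
Proof.
move=> w_gt0 t_gt0; rewrite /is_period t_gt0; apply: (iffP forallP) => h i.
  by have /eqP/= <- := h (Ordinal (ltn_pmod i w_gt0)); rewrite modnDml.
by rewrite h modn_small.
Qed.

Lemma least_period_le_size w : 0 < size w -> least_period w <= size w.
Proof.
by move=> w_gt0; apply/least_period_min/is_periodP => // i; rewrite modnDr.
Qed.

Lemma eq_rotP w i j : i <= size w -> j <= size w ->
  reflect (forall l, nth 0 w ((i + l) %% size w) = nth 0 w ((j + l) %% size w))
          (rot i w == rot j w).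
Proof.
move=> le_i le_j; have [/size0nil -> /=|w_gt0] := posnP (size w).
  by apply: (iffP idP) => // _ l; rewrite !nth_nil.
apply: (iffP eqP) => [e l|h].
  have lt_l := ltn_pmod l w_gt0.
  by rewrite -modnDmr -nth_rot // e nth_rot // modnDmr.
apply: (@eq_from_nth _ 0) => [|l]; rewrite !size_rot // => lt_l.
by rewrite !nth_rot.
Qed.

Lemma rot_lt_least_period w i : 0 < size w ->
  exists2 j, j < least_period w & rot i w = rot j w.
Proof.
move=> w_gt0; rewrite rot_minn; set c := minn i _.
have le_c : c <= size w := geq_minr _ _.
have t_gt0 := least_period_gt0 w; have le_t := least_period_le_size w_gt0.
exists (c %% least_period w); first by rewrite ltn_pmod.
apply/eqP/eq_rotP => // [|l]; first by have := ltn_pmod c t_gt0; lia.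
(* The multiples of the least period contained in [c] are stripped one at a time, by induction on
   the quotient. *)
rewrite {1}(divn_eq c (least_period w)).
have /(is_periodP w_gt0 t_gt0) per := least_periodP w.
elim: (c %/ least_period w) => [|q <-]; first by rewrite mul0n add0n.
by rewrite -[RHS]per mulSn -!addnA [X in nth 0 w (X %% _)]addnC !addnA.
Qed.

(** If [i < j] gave the same rotation, then [j - i] would be a period smaller than the least one.
    With the previous lemma, the distinct rotations of [w] are indexed by [i < least_period w]. *)
Lemma rot_least_period_inj w i j : 0 < size w ->
  i < least_period w -> j < least_period w -> rot i w = rot j w -> i = j.
Proof.
move=> w_gt0; have le_t := least_period_le_size w_gt0.
wlog le_ij : i j / i <= j => [h lt_i lt_j e|].
  by case/orP: (leq_total i j) => /h-> //.
move=> lt_i lt_j /eqP/eq_rotP h.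
have [|lt_ij] := leqP j i; first by lia.
have ij_gt0 : 0 < j - i by lia.
have : is_period w (j - i).
  apply/is_periodP => // l.
  (* Adding a full turn [size w] turns the offset [l - i] into a natural number, so that the
     equality of rotations applies. *)
  have -> : (l + (j - i)) %% size w = (j + (l + (size w - i))) %% size w.
    by rewrite -[LHS]modnDr; congr (_ %% _); lia.
  rewrite -h; try lia.
  have -> : i + (l + (size w - i)) = l + size w by lia.
  by rewrite modnDr.
by move/least_period_min; lia.
Qed.

(** * Words of first entries along orbits *)

Definition topdrop_word n (s : 'S_n) : seq nat :=
  [seq top_entry u | u <- orbit (@topdrop n) s].

Lemma size_topdrop_word n (s : 'S_n) :
  size (topdrop_word s) = order (@topdrop n) s.
Proof. by rewrite size_map size_orbit. Qed.

Lemma size_topdrop_word_gt0 n (s : 'S_n) : 0 < size (topdrop_word s).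
Proof. by rewrite size_topdrop_word -orderSpred. Qed.

Lemma nth_topdrop_word n (s : 'S_n) j : j < order (@topdrop n) s ->
  nth 0 (topdrop_word s) j = top_entry (iter j (@topdrop n) s).
Proof.
by move=> lt_j; rewrite (nth_map s) ?size_orbit // nth_traject.
Qed.

(** Every rotation of a word of first entries is thus again the word of a permutation, so the count
    of permutations with a given word applies to it. *)
Lemma topdrop_word_iter n (s : 'S_n) i : i <= size (topdrop_word s) ->
  topdrop_word (iter i (@topdrop n) s) = rot i (topdrop_word s).
Proof.
rewrite size_topdrop_word => le_i.
have eq_o : order (@topdrop n) (iter i (@topdrop n) s) = order (@topdrop n) s.
  apply: (eq_order_cycle (cycle_orbit (@topdrop_inj n) s)).
    by rewrite -fconnect_orbit connect0.
  by rewrite -fconnect_orbit fconnect_iter.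
apply: (@eq_from_nth _ 0) => [|j]; rewrite ?size_rot !size_topdrop_word // eq_o.
move=> lt_j; rewrite nth_topdrop_word ?eq_o // nth_rot ?size_topdrop_word //.
rewrite nth_topdrop_word ?ltn_pmod ?(leq_ltn_trans _ lt_j) //.
rewrite -iterD addnC {1}(divn_eq (i + j) (order (@topdrop n) s)) addnC iterD.
congr (top_entry (iter _ _ _)).
elim: (_ %/ _) => [|q IHq]; first by rewrite mul0n.
by rewrite mulSn iterD IHq (iter_order (@topdrop_inj n)).
Qed.

(** * Permutations sharing a word *)

Section Fiber.

Variable n : nat.
Implicit Types s u g : 'S_n.+1.

(** In [s * g] the factor [s] acts first, so [g] relabels values, while topdrop moves positions in a
    way that depends only on the first entry. *)
Lemma topdropM s g : g (s ord0) = s ord0 -> topdrop (s * g)%g = (topdrop s * g)%g.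
Proof.
move=> gs; apply/permP => i.
by rewrite permM !topdropE permM !top_entryS permM gs.
Qed.

Lemma iter_topdropM s g j :
  (forall l, l < j -> g (iter l (@topdrop _) s ord0) = iter l (@topdrop _) s ord0) ->
  iter j (@topdrop _) (s * g)%g = (iter j (@topdrop _) s * g)%g.
Proof.
elim: j => [//|j IHj] gs /=.
by rewrite IHj => [|l lt_l]; rewrite ?topdropM ?gs //; apply: leqW.
Qed.

Definition word_values s : {set 'I_n.+1} := [set i : 'I_n.+1 | i.+1 \in topdrop_word s].

Lemma iter_word_values s j : iter j (@topdrop _) s ord0 \in word_values s.
Proof.
by rewrite inE -top_entryS map_f // -fconnect_orbit fconnect_iter.
Qed.

Lemma card_word_values s : #|word_values s| = num_values (topdrop_word s).
Proof.
rewrite cardE -(size_map (fun i : 'I_n.+1 => i.+1)).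
apply/perm_size/uniq_perm; rewrite ?undup_uniq ?map_inj_uniq ?enum_uniq //.
  by move=> i j [/val_inj].
move=> x; rewrite mem_undup; apply/mapP/idP => [[i]|].
  by rewrite mem_enum inE => h ->.
case/mapP=> u u_orb ->; exists (u ord0); last by rewrite top_entryS.
by rewrite mem_enum inE -top_entryS map_f.
Qed.

Lemma eq_topdrop_word s g :
  (topdrop_word (s * g)%g == topdrop_word s) = perm_on (~: word_values s) g.
Proof.
apply/eqP/idP => [e|/subsetP g_on].
  have eq_o : order (@topdrop _) (s * g)%g = order (@topdrop _) s.
    by rewrite -!size_topdrop_word e.
  have gs j : j < order (@topdrop _) s ->
    g (iter j (@topdrop _) s ord0) = iter j (@topdrop _) s ord0.
    (* Once [g] fixes the earlier first entries, the [j]-th iterate from [s * g] is that from [s]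
       times [g]; comparing the letters at [j] shows that [g] fixes the next one. *)
    elim/ltn_ind: j => j IHj lt_j.
    have := nth_topdrop_word lt_j; rewrite -e nth_topdrop_word ?eq_o //.
    rewrite iter_topdropM => [|l lt_l]; last by apply: IHj => //; lia.
    by rewrite !top_entryS permM => - [/val_inj].
  apply/subsetP => i; rewrite inE; apply: contraR; rewrite !inE negbK.
  case/mapP => u; rewrite -fconnect_orbit => su.
  rewrite top_entryS => - [/val_inj ->]; rewrite -(iter_findex su).
  by apply/eqP/gs/findex_max.
have gs i : i \in word_values s -> g i = i.
  by move=> i_in; apply/eqP; apply: contraLR i_in => /g_on; rewrite inE.
have itM j := @iter_topdropM s g j (fun l _ => gs _ (iter_word_values s l)).
(* Cancelling [g] on the right, the two trajectories return to their starting points at the same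
   times. *)
have eq_o : order (@topdrop _) (s * g)%g = order (@topdrop _) s.
  have [s_gt0 sK s_min] := topdrop_orderP s.
  have [sg_gt0 sgK sg_min] := topdrop_orderP (s * g)%g.
  apply/eqP; rewrite eqn_leq sg_min ?s_min ?itM ?sK //.
  by apply: (mulIg g); rewrite -itM.
apply: (@eq_from_nth _ 0) => [|j]; rewrite !size_topdrop_word // eq_o => lt_j.
by rewrite !nth_topdrop_word ?eq_o // itM !top_entryS permM gs ?iter_word_values.
Qed.

End Fiber.

Lemma card_topdrop_word n (s : 'S_n) :
  #|[set u : 'S_n | topdrop_word u == topdrop_word s]| =
  (n - num_values (topdrop_word s))`!.
Proof.
case: n s => [|n] s.
  (* The only word here is the single letter 0, by the convention for [top_entry]; the truncated
     difference 0 - 1 is 0, which gives 0! = 1. *)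
  have -> : [set u : 'S_0 | topdrop_word u == topdrop_word s] = [set s].
    apply/setP => u; rewrite !inE; have -> : u = s by apply/permP => - [].
    by rewrite !eqxx.
  by rewrite cards1 sub0n.
rewrite -card_word_values.
have <- : #|~: word_values s| = n.+1 - #|word_values s|.
  by rewrite cardsCs setCK card_ord.
(* Left multiplication by [s] carries the permutations supported off [word_values s] bijectively
   onto the fiber of its word. *)
rewrite -card_perm -[RHS](card_imset _ (mulgI s)).
apply: eq_card => u; rewrite inE; apply/idP/imsetP => [e|[g g_on ->]].
  exists (s^-1 * u)%g; last by rewrite mulVKg.
  by rewrite -topredE /= -eq_topdrop_word mulVKg.
by rewrite eq_topdrop_word.
Qed.

Lemma card_topdrop_necklace n (s : 'S_n) :
  #|[set u : 'S_n | topdrop_necklace u == topdrop_necklace s]| =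
  least_period (topdrop_word s) * (n - num_values (topdrop_word s))`!.
Proof.
set w := topdrop_word s; set t := least_period w.
have w_gt0 : 0 < size w := size_topdrop_word_gt0 s.
have le_t : t <= size w := least_period_le_size w_gt0.
have eqN u : (topdrop_necklace u == topdrop_necklace s) =
    [exists i : 'I_t, topdrop_word u == rot i w].
  rewrite eq_sym; apply/to_necklaceP/existsP => [[i e]|[i /eqP e]].
    have [j lt_j eq_j] := rot_lt_least_period i w_gt0.
    by exists (Ordinal lt_j); apply/eqP; rewrite -eq_j.
  by exists i.
have -> : [set u : 'S_n | topdrop_necklace u == topdrop_necklace s] =
    \bigcup_(i < t) [set u : 'S_n | topdrop_word u == rot i w].
  apply/setP => u; rewrite inE eqN; apply/existsP/bigcupP => [[i e]|[i _]].
    by exists i; rewrite ?inE.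
  by rewrite inE; exists i.
(* The fibers over the [t] rotations are disjoint, since these rotations are distinct words. *)
rewrite -[LHS]sum1_card partition_disjoint_bigcup /= => [|i j].
  under eq_bigr do rewrite sum1_card.
  rewrite (eq_bigr (fun=> (n - num_values w)`!)) ?sum_nat_const ?card_ord // => i _.
  have le_i : i <= size w by apply: leq_trans le_t; apply: ltnW.
  rewrite -topdrop_word_iter // card_topdrop_word topdrop_word_iter //.
  by congr (_ - _)`!; apply/perm_size/perm_undup => x; rewrite mem_rot.
apply: contraR => /pred0Pn[u] /=; rewrite !inE => /andP[/eqP -> /eqP e].
by apply/eqP/val_inj/(rot_least_period_inj w_gt0) => /=.
Qed.

Theorem theorem4p2 (n k : nat) :
  (#|[set O in topdrop_orbits n | #|O| == k]|%:R : rat)%R =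
  (\sum_(N <- valid_necklaces n | necklace_size N == k)
     ((n - necklace_num_values N)`!)%N%:R / fundamental_period N)%R.
Proof.
have size_necklace (s : 'S_n) :
    necklace_size (topdrop_necklace s) = order (@topdrop n) s.
  by rewrite necklace_sizeE -size_topdrop_word.
(* Orbits and necklaces are never empty, so both sides vanish for [k = 0]; otherwise the identity
   may be multiplied by [k]. *)
have [->|k_gt0] := posnP k.
  rewrite big_seq_cond big_pred0 => [|N]; last first.
    apply/negP => /andP[/valid_necklacesP[s ->]].
    by rewrite size_necklace -orderSpred.
  suff -> : [set O in topdrop_orbits n | #|O| == 0] = set0 by rewrite cards0.
  apply/setP => O; rewrite !inE; apply/negP => /andP[/imsetP[s _ ->]].
  by rewrite cards_eq0 => /eqP/setP/(_ s); rewrite !inE -fconnect_orbit connect0.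
have k_neq0 : (k%:R != 0 :> rat)%R by rewrite Num.Theory.pnatr_eq0 -lt0n.
apply: (mulIf k_neq0); rewrite -natrM -card_order_orbits; last exact: topdrop_inj.
set D := [set x | _].
have -> : #|D| = \sum_(N <- valid_necklaces n | necklace_size N == k)
    #|[set u : 'S_n | topdrop_necklace u == N]|.
  under [RHS]eq_bigr do rewrite -sum1_card.
  rewrite (exchange_big_dep (fun u => u \in D)) /= => [|N u kN uN]; last first.
    by move: uN; rewrite !inE -size_necklace => /eqP ->.
  rewrite -sum1_card; apply: eq_bigr => u; rewrite inE => /eqP eq_k.
  have uN : topdrop_necklace u \in valid_necklaces n.
    by apply/valid_necklacesP; exists u.
  (* The list of necklaces has no repetition, so each [u] of order [k] is counted exactly once. *)
  transitivity (count_mem (topdrop_necklace u) (valid_necklaces n)).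
    by rewrite count_uniq_mem ?undup_uniq // uN.
  rewrite sum1_count; apply: eq_count => N /=; rewrite inE eq_sym.
  by case: eqP => [<-|]; rewrite ?andbF // size_necklace eq_k eqxx.
rewrite natr_sum mulr_suml big_seq_cond [RHS]big_seq_cond.
apply: eq_bigr => N /andP[/valid_necklacesP[s ->]]; rewrite size_necklace => /eqP eq_k.
(* With [t] the least period, the factor [k] cancels against the period [k / t] and leaves [t]. *)
rewrite card_topdrop_necklace necklace_num_valuesE fundamental_periodE.
rewrite -/(topdrop_word s) size_topdrop_word eq_k natrM invf_div.
by rewrite mulrA mulfVK // mulrC.
Qed.
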